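(* Let $L$ be a lattice of subgroups of an abelian group $A$, with meet $\cap$ and join $+$. For a finite family $I_0,\ldots,I_n$ ($n\geq 0$) of members of $L$ let ${\rm H}^{\bullet}(I_0,\ldots,I_n)$ denote the cohomology of the cochain complex $({\rm C}^{\bullet}(I_0,\ldots,I_n),d)$ defined in the context. Then: 1) For all $I_0,\ldots,I_n\in L$, ${\rm H}^{0}(I_{0},\ldots,I_{n})=I_{0}\cap\cdots\cap I_{n}$ (an element $i$ of the intersection being identified with the constant $0$-cochain $(i,\ldots,i)$). 2) If the lattice $L$ is distributive, then ${\rm H}^{q}(I_{0},\ldots,I_{n})=0$ for all $q>0$ and all $I_0,\ldots,I_n\in L$. 3) If ${\rm H}^{1}(I_{0},I_{1},I_{2})=0$ for all $I_{0},I_{1},I_{2}\in L$, then the lattice $L$ is distributive.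
   Context: A lattice $L$ of subgroups of an abelian group $A$ is a set of subgroups of $A$ closed under intersection $\cap$ (meet) and sum $+$ (join). It is distributive if $I_0+(I_1\cap I_2)=(I_0+I_1)\cap(I_0+I_2)$ for all $I_0,I_1,I_2\in L$ (equivalently, $I_0\cap(I_1+I_2)=(I_0\cap I_1)+(I_0\cap I_2)$ for all $I_0,I_1,I_2\in L$). For $I_0,\ldots,I_n\in L$ and $q\geq 0$, the group of $q$-cochains ${\rm C}^{q}(I_0,\ldots,I_n)$ is the subgroup of $$\prod_{0\leq\alpha_0,\ldots,\alpha_q\leq n}(I_{\alpha_0}+\cdots+I_{\alpha_q})$$ consisting of the families $(i_{\alpha_0\ldots\alpha_q})$ that are completely alternating in the indices, i.e. $i_{\alpha_0\ldots\alpha_q}$ changes sign when two indices are interchanged and is $0$ when two indices are equal. (Thus ${\rm C}^q$ can be identified with $\prod_{0\leq\alpha_0<\cdots<\alpha_q\leq n}(I_{\alpha_0}+\cdots+I_{\alpha_q})$.) The coboundary operator $d:{\rm C}^{q}(I_0,\ldots,I_n)\to{\rm C}^{q+1}(I_0,\ldots,I_n)$ is $$(di)_{\alpha_0\ldots\alpha_{q+1}}=\sum_{p=0}^{q+1}(-1)^p\, i_{\alpha_0\ldots\widehat{\alpha_p}\ldots\alpha_{q+1}},$$ where the hat denotes omission; one has $d\circ d=0$. *)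

(* Defs.v *)
From HB Require Import structures.
From mathcomp Require Import all_boot all_fingroup all_algebra zify.
From mathcomp Require Import boolp classical_sets.

Set Implicit Arguments.
Unset Strict Implicit.
Unset Printing Implicit Defensive.

Import GRing.Theory.
Local Open Scope ring_scope.
Local Open Scope quotient_scope.

(* A subgroup of V is a [zmodClosed V]. Its boolean membership is no           *)
(* restriction, since every proposition is decidable by [asbool].              *)
Section Subgroups.
Variable V : zmodType.
Implicit Types I J : zmodClosed V.

Lemma subgroup_ext I J : I =i J -> I = J.
Proof.
case: I => f [[f1] [f2]]; case: J => g [[g1] [g2]] fg.
have efg : f = g by apply/funext => x; exact: (fg x).
case: g / efg g1 g2 {fg} => g1 g2.
congr (GRing.ZmodClosed.Pack (GRing.ZmodClosed.Class _ _));
  [congr (GRing.isOppClosed.Axioms_ _) | congr (GRing.isAddClosed.Axioms_ _)];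
  exact: Prop_irrelevance.
Qed.

Definition zero_pred : V -> bool := fun x => x == 0.
Definition full_pred : V -> bool := fun _ => true.
Definition meet_pred I J : V -> bool := fun x => (x \in I) && (x \in J).
Definition join_pred I J : V -> bool :=
  fun x => `[< exists2 y, y \in I & exists2 z, z \in J & x = y + z >].

Fact zero_pred_closed : zmod_closed zero_pred.
Proof. by split=> [|x y /eqP-> /eqP->]; apply/eqP; rewrite ?subr0. Qed.

Fact full_pred_closed : zmod_closed full_pred. Proof. by []. Qed.

Fact meet_pred_closed I J : zmod_closed (meet_pred I J).
Proof.
split=> [|x y /andP[xI xJ] /andP[yI yJ]]; apply/andP; split;
  by rewrite ?rpred0 ?rpredB.
Qed.

Fact join_pred_closed I J : zmod_closed (join_pred I J).
Proof.
split=> [|x x' /asboolP[y yI [z zJ ->]] /asboolP[y' y'I [z' z'J ->]]].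
  by apply/asboolP; exists 0; [exact: rpred0 | exists 0; rewrite ?rpred0 ?addr0].
apply/asboolP; exists (y - y'); first exact: rpredB.
by exists (z - z'); [exact: rpredB | rewrite opprD addrACA].
Qed.

HB.instance Definition _ := GRing.isZmodClosed.Build V zero_pred zero_pred_closed.
HB.instance Definition _ := GRing.isZmodClosed.Build V full_pred full_pred_closed.
HB.instance Definition _ I J :=
  GRing.isZmodClosed.Build V (meet_pred I J) (meet_pred_closed I J).
HB.instance Definition _ I J :=
  GRing.isZmodClosed.Build V (join_pred I J) (join_pred_closed I J).

Definition zero_subgroup : zmodClosed V := GRing.ZmodClosed.clone _ zero_pred _.
Definition full_subgroup : zmodClosed V := GRing.ZmodClosed.clone _ full_pred _.
Definition subgroup_meet I J : zmodClosed V := GRing.ZmodClosed.clone _ (meet_pred I J) _.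
Definition subgroup_join I J : zmodClosed V := GRing.ZmodClosed.clone _ (join_pred I J) _.

Record subgroup_type (I : zmodClosed V) :=
  SubgroupType { subgroup_val : V; _ : subgroup_val \in I }.

HB.instance Definition _ I := [isSub for @subgroup_val I].
HB.instance Definition _ I := [Choice of subgroup_type I by <:].
HB.instance Definition _ I := [SubChoice_isSubZmodule of subgroup_type I by <:].

Fact subgroup_val_is_zmod_morphism I : zmod_morphism (@subgroup_val I).
Proof. exact: (raddfB (\val : subgroup_type I -> V)). Qed.
HB.instance Definition _ I := GRing.isZmodMorphism.Build _ _ (@subgroup_val I)
  (@subgroup_val_is_zmod_morphism I).

End Subgroups.

Section Lattices.
Variable A : zmodType.
Local Open Scope classical_set_scope.
Implicit Type L : set (zmodClosed A).

Definition subgroup_lattice L : Prop :=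
  forall I J, L I -> L J -> L (subgroup_meet I J) /\ L (subgroup_join I J).

Definition distributive_lattice L : Prop :=
  forall I0 I1 I2, L I0 -> L I1 -> L I2 ->
    subgroup_join I0 (subgroup_meet I1 I2) =
    subgroup_meet (subgroup_join I0 I1) (subgroup_join I0 I2).

End Lattices.

Definition multi_index (n q : nat) := {ffun 'I_q.+1 -> 'I_n.+1}.

Section Cohomology.
Variables (A : zmodType) (n : nat).

(* The components are unconstrained here: [cochains] below puts c a in         *)
(* I (a 0) + ... + I (a q), which embeds the product of these sums in A-valued *)
(* families.                                                                   *)
Definition indexed_family (q : nat) := {ffun multi_index n q -> A}.
HB.instance Definition _ q := GRing.Zmodule.on (indexed_family q).

Definition swap q (a : multi_index n q) (j k : 'I_q.+1) : multi_index n q :=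
  [ffun p => a (tperm j k p)].

Definition omit q (a : multi_index n q.+1) (p : 'I_q.+2) : multi_index n q :=
  [ffun k => a (lift p k)].

Definition alternating q (c : indexed_family q) : Prop :=
  (forall (a : multi_index n q) (j k : 'I_q.+1), j != k -> c (swap a j k) = - c a) /\
  (forall (a : multi_index n q) (j k : 'I_q.+1), j != k -> a j = a k -> c a = 0).

Definition coboundary q (c : indexed_family q) : indexed_family q.+1 :=
  [ffun a => \sum_(p < q.+2) c (omit a p) *~ (-1) ^+ p].

Fact coboundary_is_zmod_morphism q : zmod_morphism (@coboundary q).
Proof.
move=> c c'; apply/ffunP => a; rewrite !ffunE -sumrB; apply: eq_bigr => p _.
by rewrite !ffunE mulrzBl.
Qed.
HB.instance Definition _ q := GRing.isZmodMorphism.Build _ _ (@coboundary q)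
  (@coboundary_is_zmod_morphism q).

Variable I : 'I_n.+1 -> zmodClosed A.

Definition index_sum q (a : multi_index n q) : zmodClosed A :=
  \big[@subgroup_join A / zero_subgroup A]_(p < q.+1) I (a p).

Fact mem_index_sum q (a : multi_index n q) p x : x \in I (a p) -> x \in index_sum a.
Proof.
rewrite /index_sum; elim: (index_enum _) (mem_index_enum p) => // p' s IH.
rewrite inE big_cons => /orP[/eqP<- xI|/IH{}IH /IH xS]; apply/asboolP.
  by exists x => //; exists 0; rewrite ?rpred0 ?addr0.
by exists 0; rewrite ?rpred0 //; exists x; rewrite ?add0r.
Qed.

Fact index_sum_sub q (a : multi_index n q) (S : zmodClosed A) :
  (forall p, {subset I (a p) <= S}) -> {subset index_sum a <= S}.
Proof.
move=> aS; rewrite /index_sum; elim/big_ind: _ => [x /eqP->|J K JS KS x|p _].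
- exact: rpred0.
- by move=> /asboolP[y yJ [z zK ->]]; apply: rpredD; [exact: JS | exact: KS].
- exact: aS.
Qed.

Definition cochain_pred q : indexed_family q -> bool :=
  fun c => `[< (forall a, c a \in index_sum a) /\ alternating c >].

Fact cochain_pred_closed q : zmod_closed (@cochain_pred q).
Proof.
split=> [|c c' /asboolP[cI [cN c0]] /asboolP[c'I [c'N c'0]]]; apply/asboolP.
  split=> [a|]; first by rewrite ffunE rpred0.
  by split=> *; rewrite !ffunE ?oppr0.
split=> [a|]; first by rewrite !ffunE rpredB.
split=> [a j k jk|a j k jk ajk]; rewrite !ffunE.
  by rewrite cN // c'N // opprD.
by rewrite (c0 a j k) // (c'0 a j k) // subr0.
Qed.
HB.instance Definition _ q :=
  GRing.isZmodClosed.Build (indexed_family q) (@cochain_pred q) (@cochain_pred_closed q).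
Definition cochains q : zmodClosed (indexed_family q) :=
  GRing.ZmodClosed.clone _ (@cochain_pred q) _.

Definition cocycle_pred q : indexed_family q -> bool :=
  fun c => (c \in cochains q) && (coboundary c == 0).

Fact cocycle_pred_closed q : zmod_closed (@cocycle_pred q).
Proof.
split=> [|c c' /andP[cC /eqP dc] /andP[c'C /eqP dc']]; apply/andP.
  by rewrite rpred0 raddf0.
by rewrite rpredB // raddfB /= dc dc' subrr.
Qed.
HB.instance Definition _ q :=
  GRing.isZmodClosed.Build (indexed_family q) (@cocycle_pred q) (@cocycle_pred_closed q).
Definition cocycles q : zmodClosed (indexed_family q) :=
  GRing.ZmodClosed.clone _ (@cocycle_pred q) _.

(* There are no cochains in degree -1, so only 0 is a coboundary in degree 0.  *)
Definition is_coboundary q : indexed_family q -> Prop :=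
  match q with
  | 0 => fun c => c = 0
  | q'.+1 => fun c => exists2 b, b \in cochains q' & c = coboundary b
  end.

(* The coboundaries, as a subgroup of the group of cocycles.                   *)
Definition coboundary_pred q : subgroup_type (cocycles q) -> bool :=
  fun z => `[< is_coboundary (subgroup_val z) >].

Fact coboundary_pred_closed q : zmod_closed (@coboundary_pred q).
Proof.
case: q => [|q].
  split=> [|z z' /asboolP z0 /asboolP z'0]; apply/asboolP; rewrite /= ?raddf0 ?raddfB //.
  by rewrite z0 z'0 subrr.
split=> [|z z' /asboolP[b bC zb] /asboolP[b' b'C z'b']]; apply/asboolP.
  by exists 0; [exact: rpred0 | rewrite !raddf0].
by exists (b - b'); [exact: rpredB | rewrite [RHS]raddfB /= -zb -z'b'].
Qed.
HB.instance Definition _ q := GRing.isZmodClosed.Build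
  (subgroup_type (cocycles q)) (@coboundary_pred q) (@coboundary_pred_closed q).
Definition coboundaries q : zmodClosed (subgroup_type (cocycles q)) :=
  GRing.ZmodClosed.clone _ (@coboundary_pred q) _.

Definition cohomology q : zmodType := Quotient.quot (coboundaries q).

Definition cohomology_class q (z : subgroup_type (cocycles q)) : cohomology q :=
  \pi_(Quotient.quot (coboundaries q)) z.

Fact alternating_perm q (c : indexed_family q) : alternating c ->
  forall (a : multi_index n q) (s : 'S_q.+1),
    c [ffun p => a (s p)] = c a *~ (-1) ^+ s.
Proof.
move=> [cN _] a s; have [ts -> /allP dts] := prod_tpermP s.
elim: ts dts => [|t ts IH] dts.
  rewrite big_nil odd_perm1 expr0; congr (c _).
  by apply/ffunP => p; rewrite ffunE perm1.
have dt : t.1 != t.2 by apply: dts; rewrite inE eqxx.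
rewrite big_cons odd_mul_tperm dt signr_addb expr1 mulN1r mulrNz -IH; last first.
  by move=> u uts; apply: dts; rewrite inE uts orbT.
rewrite -(cN _ _ _ dt); congr (c _).
by apply/ffunP => p; rewrite !ffunE permM.
Qed.

Fact lift_perm_exists m (s : 'S_m.+1) p :
  exists t : 'S_m, s = lift_perm p (s p) t.
Proof.
pose f k := odflt k (unlift (s p) (s (lift p k))).
have fE k : lift (s p) (f k) = s (lift p k).
  rewrite /f; case: unliftP => [j -> //|/perm_inj/eqP].
  by rewrite eq_sym (negPf (neq_lift _ _)).
have f_inj : injective f.
  move=> k k' ff; apply: (@lift_inj _ p); apply: (@perm_inj _ s).
  by rewrite -!fE ff.
exists (perm f_inj); apply/permP => k.
case: (unliftP p k) => [j ->|->]; last by rewrite lift_perm_id.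
by rewrite lift_perm_lift permE fE.
Qed.

Fact omit_perm q (c : indexed_family q) (a : multi_index n q.+1) (s : 'S_q.+2) p :
  alternating c ->
  c (omit [ffun k => a (s k)] p) *~ (-1) ^+ p
  = c (omit a (s p)) *~ (-1) ^+ s p *~ (-1) ^+ s.
Proof.
move=> calt; have [t st] := lift_perm_exists s p.
have -> : omit [ffun k => a (s k)] p = [ffun k => omit a (s p) (t k)].
  by apply/ffunP => k; rewrite !ffunE {1}st lift_perm_lift.
rewrite alternating_perm // -!mulrzA; congr (_ *~ _).
have -> : odd_perm s = odd p (+) odd (s p) (+) odd_perm t.
  by rewrite {1}st odd_lift_perm.
rewrite -(signr_odd _ p) -(signr_odd _ (s p)).
by case: (odd p); case: (odd (s p)); case: (odd_perm t).
Qed.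

(* The coboundary of a cochain is a cocycle, so [coboundaries q.+1] is the     *)
(* whole image of [cochains q].                                                *)
Lemma coboundary_cochain q c :
  c \in cochains q -> coboundary c \in cochains q.+1.
Proof.
move=> /asboolP[cI calt]; apply/asboolP; split=> [a|].
  rewrite ffunE; apply: rpred_sum => p _; apply: rpredMz.
  move: (cI (omit a p)); apply: index_sum_sub => k x xI.
  by apply: (@mem_index_sum _ _ (lift p k)); rewrite ffunE in xI.
split=> [a j k jk|a j k jk ajk].
  rewrite !ffunE -sumrN [in RHS](reindex_inj (@perm_inj _ (tperm j k))).
  apply: eq_bigr => p _; rewrite (omit_perm a (tperm j k) p) //.
  by rewrite odd_tperm jk mulrN1z.
rewrite ffunE (bigD1 j) // (bigD1 k) /=; last by rewrite eq_sym.
rewrite big1 ?addr0; last first.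
  move=> p /andP[pj pk]; case: calt => _ c0.
  case: (unliftP p j) pj => [j' jE _|->]; last by rewrite eqxx.
  case: (unliftP p k) pk => [k' kE _|->]; last by rewrite eqxx.
  rewrite (c0 _ j' k') ?mul0rz //.
    by apply: contra_neq jk => e; rewrite jE kE e.
  by rewrite !ffunE -jE -kE.
have -> : omit a j = omit [ffun p => a (tperm j k p)] j.
  congr omit; apply/ffunP => p; rewrite ffunE.
  by case: tpermP => [->|->|//].
by rewrite omit_perm // tpermL odd_tperm jk mulrN1z addNr.
Qed.

Lemma coboundaryK q (c : indexed_family q) : coboundary (coboundary c) = 0.
Proof.
apply/ffunP => a; rewrite !ffunE.
pose F (u : 'I_q.+3 * 'I_q.+2) := c (omit (omit a u.1) u.2) *~ (-1) ^+ (u.1 + u.2).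
transitivity (\sum_u F u).
  rewrite -(pair_bigA _ (fun p r => F (p, r))) /=; apply: eq_bigr => p _.
  rewrite ffunE mulrz_suml; apply: eq_bigr => r _.
  by rewrite -mulrzA -exprD addnC.
pose lo (u : 'I_q.+3 * 'I_q.+2) := (u.2 < u.1)%N.
pose h (u : 'I_q.+3 * 'I_q.+2) : 'I_q.+3 * 'I_q.+2 :=
  (inord u.2, inord u.1.-1).
pose h' (u : 'I_q.+3 * 'I_q.+2) : 'I_q.+3 * 'I_q.+2 :=
  (inord u.2.+1, inord u.1).
rewrite (bigID lo) /= [X in _ + X](reindex_onto h h') /=; last first.
  move=> [p r]; rewrite /lo /h /h' -leqNgt /= => pr.
  have p_lt : (p < q.+2)%N by apply: leq_ltn_trans pr _.
  congr pair; apply: val_inj => /=; first by rewrite !inordK.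
  have e : (inord r.+1 : 'I_q.+3) = r.+1 :> nat by rewrite inordK //; exact: (ltn_ord r).
  by rewrite e /= inord_val.
rewrite [X in _ + X](eq_bigl lo); last first.
  move=> [p r]; rewrite /lo /h /h' -leqNgt /=.
  have r_lt : (r < q.+3)%N by apply: ltn_trans (ltn_ord r) _.
  have p_lt : (p.-1 < q.+2)%N by case: p => -[|p] //=.
  rewrite !inordK // xpair_eqE -!val_eqE /= inordK; last by case: p {r_lt} p_lt => -[|p].
  rewrite inordK // eqxx andbT.
  by case: p {p_lt} => -[|p] /=; rewrite ?ltn0 ?ltnS ?eqxx ?andbT ?andbF.
rewrite -big_split big1 //= => -[p r]; rewrite /lo /= => rp.
rewrite /F /h /=.
have r_lt : (r < q.+3)%N by apply: ltn_trans (ltn_ord r) _.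
have p_lt : (p.-1 < q.+2)%N by case: p {rp} => -[|p] //=.
rewrite !inordK // addnC -[in X in X + _](prednK (leq_ltn_trans (leq0n r) rp)).
rewrite addnS exprS mulN1r mulrNz.
have -> : omit (omit a (inord r)) (inord p.-1) = omit (omit a p) r; last first.
  by rewrite addNr.
apply/ffunP => k; rewrite !ffunE; congr (a _); apply: val_inj.
rewrite /= !inordK // /bump.
case: p rp {p_lt} => -[|p] //= _; rewrite ltnS => rp.
lia.
Qed.

Lemma coboundary_cocycle q c : c \in cochains q -> coboundary c \in cocycles q.+1.
Proof.
by move=> cC; apply/andP; rewrite coboundary_cochain ?coboundaryK.
Qed.

End Cohomology.

(* Main.v *)
Require Import Defs.
From HB Require Import structures.
From mathcomp Require Import all_boot all_algebra perm.
From mathcomp Require Import boolp classical_sets.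

Set Implicit Arguments.
Unset Strict Implicit.
Unset Printing Implicit Defensive.

Import GRing.Theory.
Local Open Scope ring_scope.

(** The theorem has three independent parts.

    In degree 0 a cocycle is a family indexed by the vertices whose entries all
    agree; its common value lies in every I_k, and there are no coboundaries to
    divide by ([cocycle0_constant], [constant_class_bij]).

    Exactness in positive degree for a distributive lattice ([exact_over]) is an
    induction on the set s of vertices, adding one vertex k at a time. The index
    type is kept fixed: only the equation c = d b is restricted to the
    multi-indices with values in s, so that cochains never have to be
    transported between index types. Given c, the induction hypothesis and a
    subtraction of a coboundary reduce to a c that vanishes over s. Contraction
    with the vertex k, e_a = c_{k a}, then gives a cochain of one degree less
    for the family I_j + I_k, and e is closed over s, because contraction with k
    is a homotopy between 0 and the identity ([coboundary_contract]) and c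
    vanishes over s. If e has
    positive degree, the induction hypothesis for the family I_j + I_k gives
    e = d f over s; extended alternately so that g_{k b} = - f_b, and by 0 away
    from k, f becomes a cochain g for the original family, since a multi-index
    containing k already has I_k in its sum ([cone_extension]), and c = d g over
    k and s.  If e has degree 0, it is constant over s with value in the
    intersection of the I_j + I_k; distributivity says exactly that this
    intersection is (the intersection of the I_j) + I_k, and a decomposition
    e = y + z gives the 0-cochain with value y on s and - z at k
    ([distributive_split]).

    Conversely, given x in (I_0 + I_1) and (I_0 + I_2), the alternating family
    with entries x at 01, x at 02 and 0 at 12 is a 1-cocycle for (I_0, I_1, I_2).
    If it is the coboundary of (v_0, v_1, v_2), then v_1 = v_2 lies in both I_1
    and I_2, and x = v_1 - v_0 lies in I_0 + (I_1 meet I_2)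
    ([distributive_of_exact1]). *)

(** * Sums and intersections of subgroups *)

Section Subgroups.
Variable A : zmodType.
Implicit Types I J K : zmodClosed A.

Lemma meetP I J x : reflect (x \in I /\ x \in J) (x \in subgroup_meet I J).
Proof. exact: andP. Qed.

Lemma joinP I J x :
  reflect (exists2 y, y \in I & exists2 z, z \in J & x = y + z)
    (x \in subgroup_join I J).
Proof. exact: asboolP. Qed.

Lemma join_subl I J : {subset I <= subgroup_join I J}.
Proof. by move=> x xI; apply/joinP; exists x => //; exists 0; rewrite ?rpred0 ?addr0. Qed.

Lemma join_subr I J : {subset J <= subgroup_join I J}.
Proof. by move=> x xJ; apply/joinP; exists 0; rewrite ?rpred0 //; exists x; rewrite ?add0r. Qed.

Lemma join_subP I J K :
  {subset I <= K} -> {subset J <= K} -> {subset subgroup_join I J <= K}.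
Proof. by move=> IK JK x /joinP[y /IK yK [z /JK zK ->]]; exact: rpredD. Qed.

Lemma big_meetP n (I : 'I_n -> zmodClosed A) x :
  reflect (forall k, x \in I k)
    (x \in \big[@subgroup_meet A / full_subgroup A]_(k < n) I k).
Proof.
apply: (iffP idP) => [xI k|xI]; last by elim/big_ind: _ => // J K xJ xK; apply/meetP.
elim: (index_enum _) (mem_index_enum k) xI => // j s IH; rewrite inE big_cons.
by move=> /orP[/eqP<- /meetP[]|/IH{}IH /meetP[_ /IH]].
Qed.

Lemma join_meet_sub I J K :
  {subset subgroup_join I (subgroup_meet J K)
    <= subgroup_meet (subgroup_join I J) (subgroup_join I K)}.
Proof.
apply: join_subP => x; first by move=> xI; apply/meetP; split; apply: join_subl.
by move=> /meetP[xJ xK]; apply/meetP; split; apply: join_subr.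
Qed.

(** By induction on s, distributivity turns the intersection of the groups
    K + J_j into K + M, where M is the intersection of the J_j. The
    induction starts from a singleton, as the empty intersection need not
    belong to L. *)
Lemma distributive_split (T : eqType) (L : set (zmodClosed A)) (K : zmodClosed A)
    (J : T -> zmodClosed A) (s : seq T) (e : T -> A) :
    subgroup_lattice L -> distributive_lattice L -> L K -> (forall j, L (J j)) ->
    {in s, forall j, e j \in subgroup_join (J j) K} ->
    {in s &, forall i j, e i = e j} ->
  exists y z, z \in K /\ {in s, forall j, y \in J j /\ e j = y + z}.
Proof.
move=> latL distrL LK LJ eJK econst.
case: s eJK econst => [|j0 s] eJK econst; first by exists 0, 0; rewrite rpred0.
suff /joinP[z zK [y yM e0]] : e j0 \in subgroup_join K
    (foldr (fun j => subgroup_meet (J j)) (J j0) s).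
  exists y, z; split=> // j js; split; last first.
    by rewrite addrC -e0; apply: econst => //; rewrite inE eqxx.
  move: js yM {e0 econst eJK}; rewrite inE => /orP[/eqP-> {j}|].
    by elim: s => //= i s IH /meetP[_].
  elim: s => //= i s IH; rewrite inE => /orP[/eqP-> /meetP[]//|js /meetP[_]].
  exact: IH.
have eK j : j \in j0 :: s -> e j0 \in subgroup_join K (J j).
  move=> js; have /joinP[y yJ [z zK ->]] : e j0 \in subgroup_join (J j) K.
    by rewrite (econst j0 j) ?eJK // inE eqxx.
  by apply/joinP; exists z => //; exists y; rewrite // addrC.
have LM t : L (foldr (fun j => subgroup_meet (J j)) (J j0) t).
  by elim: t => //= j t IH; case: (latL _ _ (LJ j) IH).
have: {subset s <= j0 :: s} by move=> j js; rewrite inE js orbT.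
elim: {1 3}s => [_|j t IH ts] /=; first by apply: eK; rewrite inE eqxx.
rewrite -[_ \in _]/(_ \in subgroup_join K (subgroup_meet (J j) _)).
rewrite (distrL _ _ _ LK (LJ j) (LM t)); apply/meetP; split.
  by apply: eK; apply: ts; rewrite inE eqxx.
by apply: IH => i it; apply: ts; rewrite inE it orbT.
Qed.

End Subgroups.

(** * Cochains and contraction with a vertex *)

Section Cochains.
Variables (A : zmodType) (n : nat).
Implicit Types (I : 'I_n.+1 -> zmodClosed A) (k : 'I_n.+1) (s : seq 'I_n.+1).

Lemma cochainsP I q (c : indexed_family A n q) :
  reflect ((forall a, c a \in index_sum I a) /\ alternating c) (c \in cochains I q).
Proof. exact: asboolP. Qed.

Lemma cohomology_class_eq0 I q (z : subgroup_type (cocycles I q)) :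
  (cohomology_class z == 0) = `[< is_coboundary I (subgroup_val z) >].
Proof.
rewrite -[0](raddf0 (\pi_(Quotient.quot (coboundaries I q)))%qT).
by rewrite -Quotient.idealrBE subr0.
Qed.

Lemma cohomology_eq0P I q :
  (forall c, c \in cocycles I q -> is_coboundary I c) <->
  (forall h : cohomology I q, h = 0).
Proof.
split=> [cob h|H c cZ].
  elim/quotW: h => -[c cZ]; apply/eqP; rewrite cohomology_class_eq0.
  exact/asboolP/cob.
have /eqP := H (cohomology_class (SubgroupType cZ)).
by rewrite cohomology_class_eq0 => /asboolP.
Qed.

Definition over s q (a : multi_index n q) := forall p, a p \in s.

Lemma family_subE q (c c' : indexed_family A n q) a : (c - c') a = c a - c' a.
Proof. by rewrite ffunE [X in _ + X]ffunE. Qed.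

Definition prepend k q (a : multi_index n q) : multi_index n q.+1 :=
  [ffun p => if unlift ord0 p is Some p' then a p' else k].

Definition contract k q (c : indexed_family A n q.+1) : indexed_family A n q :=
  [ffun a => c (prepend k a)].

Lemma prepend0 k q (a : multi_index n q) : prepend k a ord0 = k.
Proof. by rewrite ffunE unlift_none. Qed.

Lemma prependS k q (a : multi_index n q) p : prepend k a (lift ord0 p) = a p.
Proof. by rewrite ffunE liftK. Qed.

Lemma omit_prepend0 k q (a : multi_index n q) : omit (prepend k a) ord0 = a.
Proof. by apply/ffunP => p; rewrite ffunE prependS. Qed.

Lemma omit_prependS k q (a : multi_index n q.+1) p :
  omit (prepend k a) (lift ord0 p) = prepend k (omit a p).
Proof.
apply/ffunP => r; rewrite ffunE; case: (unliftP ord0 r) => [r'|] ->.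
  rewrite prependS (_ : lift _ _ = lift ord0 (lift p r')) ?prependS ?ffunE //.
  by apply: val_inj; rewrite /= bumpS.
rewrite prepend0 (_ : lift _ _ = ord0) ?prepend0 //; exact: val_inj.
Qed.

Lemma omit_prepend1 k (a : multi_index n 0) :
  omit (prepend k a) (lift ord0 ord0) = [ffun=> k].
Proof.
apply/ffunP => p; rewrite [LHS]ffunE [RHS]ffunE (_ : lift _ _ = ord0) ?prepend0 //.
by apply: ord_inj; rewrite (ord1 p).
Qed.

Lemma prependK q (a : multi_index n q.+1) : prepend (a ord0) (omit a ord0) = a.
Proof.
apply/ffunP => p; case: (unliftP ord0 p) => [p'|] ->; last by rewrite prepend0.
by rewrite prependS ffunE.
Qed.

Lemma over_omit s q (a : multi_index n q.+1) p : over s a -> over s (omit a p).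
Proof. by move=> sa r; rewrite ffunE. Qed.

(** Contraction with a vertex is a contracting homotopy: omitting the initial k
    from k a gives a, and the other omissions give the coboundary of the
    contraction with the opposite sign. *)
Lemma coboundary_contract k q (c : indexed_family A n q.+1) a :
  coboundary c (prepend k a) = c a - coboundary (contract k c) a.
Proof.
rewrite !ffunE big_ord_recl omit_prepend0 expr0 mulr1z; congr (_ + _).
rewrite -sumrN; apply: eq_bigr => p _.
by rewrite omit_prependS exprS mulN1r mulrNz ffunE.
Qed.

Lemma coboundary0E (c : indexed_family A n 0) (a : multi_index n 1) :
  coboundary c a = c (omit a ord0) - c (omit a (lift ord0 ord0)).
Proof. by rewrite ffunE big_ord_recl big_ord1 expr0 mulr1z expr1 mulrN1z. Qed.

Lemma alternating0 (c : indexed_family A n 0) : alternating c.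
Proof. by split=> a j k; rewrite !ord1. Qed.

Lemma index_sum0 I (a : multi_index n 0) : {subset index_sum I a <= I (a ord0)}.
Proof. by apply: index_sum_sub => p x; rewrite ord1. Qed.

(** The price of contracting with k is the extra summand I_k, absorbed
    here by replacing each I_j by I_j + I_k. *)
Lemma contract_cochain I k q (c : indexed_family A n q.+1) : c \in cochains I q.+1 ->
  contract k c \in cochains (fun j => subgroup_join (I j) (I k)) q.
Proof.
move=> /cochainsP[cI [cN c0]]; apply/cochainsP; split=> [a|].
  rewrite ffunE; move: (cI (prepend k a)); apply: index_sum_sub => p x.
  case: (unliftP ord0 p) => [p'|] ->; rewrite (prepend0, prependS) => xI.
    by apply: (mem_index_sum (p := p')); apply: join_subl.
  by apply: (mem_index_sum (p := ord0)); apply: join_subr.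
split=> a i j ij; rewrite !ffunE; last first.
  by move=> aij; apply: (c0 _ (lift ord0 i) (lift ord0 j));
    rewrite ?(inj_eq lift_inj) ?prependS.
rewrite -(cN _ (lift ord0 i) (lift ord0 j)) ?(inj_eq lift_inj) //; congr (c _).
apply/ffunP => p; case: (unliftP ord0 p) => [p'|] ->; rewrite [RHS]ffunE.
  rewrite prependS ffunE -(prependS k); congr (prepend k a _).
  case: (tpermP i j p') => [->|->|/eqP ni /eqP nj]; first by rewrite tpermL.
    by rewrite tpermR.
  by rewrite tpermD // (inj_eq lift_inj) eq_sym.
by rewrite tpermD ?neq_lift ?prepend0 // eq_sym neq_lift.
Qed.

(** * Extending a cochain alternately to a cone *)

Definition avoids k q (a : multi_index n q) := [forall p, a p != k].

Definition restrict_off k q (c : indexed_family A n q) : indexed_family A n q :=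
  [ffun a => if avoids k a then c a else 0].

Lemma avoids_swap k q (a : multi_index n q) i j : avoids k (swap a i j) = avoids k a.
Proof.
apply/forallP/forallP => + p; last by rewrite ffunE.
by move=> /(_ (tperm i j p)); rewrite ffunE tpermK.
Qed.

Lemma over_avoids k s q (a : multi_index n q) : k \notin s -> over s a -> avoids k a.
Proof. by move=> ks sa; apply/forallP => p; apply: contraNneq ks => <-. Qed.

Lemma avoids_prepend k q (a : multi_index n q) : avoids k (prepend k a) = false.
Proof. by apply/forallP => /(_ ord0); rewrite prepend0 eqxx. Qed.

Lemma restrict_off_cochain I k q (c : indexed_family A n q) :
  c \in cochains I q -> restrict_off k c \in cochains I q.
Proof.
move=> /cochainsP[cI [cN c0]]; apply/cochainsP; split=> [a|].
  by rewrite ffunE; case: ifP; rewrite ?rpred0.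
split=> [a i j ij|a i j ij aij]; rewrite !ffunE.
  by rewrite avoids_swap cN //; case: ifP; rewrite ?oppr0.
by rewrite (c0 a i j) // if_same.
Qed.

(** This is the alternating extension by the values - f_b at k b: on a
    multi-index containing k exactly once, every term of the coboundary of the
    restriction of f vanishes except the one that omits k. Describing it by
    coboundaries and restrictions makes it alternating for free. *)
Definition cone_extension k q (f : indexed_family A n q) : indexed_family A n q.+1 :=
  restrict_off k (coboundary (restrict_off k f)) - coboundary (restrict_off k f).

(** The converse of [contract_cochain]: on a multi-index containing k the extra
    summand I_k is already part of the sum, and elsewhere the extension is 0. *)
Lemma cone_extension_cochain I k q (f : indexed_family A n q) :
  f \in cochains (fun j => subgroup_join (I j) (I k)) q ->
  cone_extension k f \in cochains I q.+1.
Proof.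
move=> /(restrict_off_cochain k)/coboundary_cochain dC.
have /cochainsP[_ galt] := rpredB (restrict_off_cochain k dC) dC.
apply/cochainsP; split=> // a; rewrite !ffunE /=.
case: ifPn => [_|/forallPn[p /negPn/eqP ap]]; first by rewrite subrr rpred0.
rewrite sub0r rpredN; have /cochainsP[+ _] := dC; move=> /(_ a); rewrite ffunE.
apply: index_sum_sub => r; apply: join_subP => x xI.
  exact: mem_index_sum xI.
by apply: (mem_index_sum (p := p)); rewrite ap.
Qed.

Lemma coboundary_restrict_off k q (f : indexed_family A n q) b :
  coboundary (restrict_off k f) (prepend k b) = restrict_off k f b.
Proof.
rewrite ffunE big_ord_recl omit_prepend0 expr0 mulr1z big1 ?addr0 // => p _.
rewrite ffunE ifN ?mul0rz //; apply/forallPn; exists ord0.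
by rewrite ffunE (_ : lift _ _ = ord0) ?prepend0 ?eqxx //; apply: val_inj.
Qed.

Lemma eq_coboundary s q (c c' : indexed_family A n q) a :
  (forall b, over s b -> c b = c' b) -> over s a -> coboundary c a = coboundary c' a.
Proof.
move=> cc' sa; rewrite !ffunE; apply: eq_bigr => p _; congr (_ *~ _).
exact/cc'/over_omit.
Qed.

Lemma cone_extension0 k q (f : indexed_family A n q) a :
  avoids k a -> cone_extension k f a = 0.
Proof. by move=> ka; rewrite !ffunE /= ka subrr. Qed.

Lemma coboundary_cone_extension s k q (f : indexed_family A n q) a :
  k \notin s -> over s a ->
  coboundary (cone_extension k f) (prepend k a) = coboundary f a.
Proof.
move=> ks sa; rewrite coboundary_contract cone_extension0 ?(over_avoids ks) //.
transitivity (coboundary (- contract k (cone_extension k f)) a).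
  by rewrite sub0r raddfN [RHS]ffunE.
apply: (eq_coboundary _ sa) => b sb.
rewrite ffunE [contract _ _ _]ffunE ffunE [restrict_off _ _ _]ffunE avoids_prepend.
by rewrite ffunE sub0r opprK coboundary_restrict_off ffunE (over_avoids ks sb).
Qed.

(** If k occurs in a, a transposition moves it to the front; if it occurs again
    afterwards, alternation gives 0 at once. *)
Lemma vanish_over_cons s k q (c : indexed_family A n q.+1) : alternating c ->
  (forall a, over s a -> c a = 0) ->
  (forall a, over s a -> c (prepend k a) = 0) ->
  forall a, over (k :: s) a -> c a = 0.
Proof.
move=> [cN c0] cs cks a sa.
have [/forallP ka|/forallPn[p /negPn/eqP ap]] := boolP (avoids k a).
  by apply: cs => p; have := sa p; rewrite inE (negPf (ka p)).
wlog p0 : a p sa ap / p = ord0.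
  case: (eqVneq p ord0) => [p0|np] H; first exact: (H a p).
  apply: oppr_inj; rewrite oppr0 -(cN a ord0 p) 1?eq_sym //.
  by apply: (H _ ord0) => // [r|]; rewrite ffunE ?tpermL.
rewrite {}p0 in ap.
have [/forallP ka|/forallPn[r /negPn/eqP]] := boolP (avoids k (omit a ord0)).
  rewrite -(prependK a) ap; apply: cks => r.
  by have := sa (lift ord0 r); have := ka r; rewrite !ffunE inE => /negPf->.
by rewrite ffunE => ar; apply: (c0 a ord0 (lift ord0 r)); rewrite ?neq_lift // ap ar.
Qed.

(** * Exactness in positive degree *)

Lemma exact_over (L : set (zmodClosed A)) I s r (c : indexed_family A n r.+1) :
    subgroup_lattice L -> distributive_lattice L -> (forall j, L (I j)) ->
    c \in cochains I r.+1 -> (forall a, over s a -> coboundary c a = 0) ->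
  exists2 b, b \in cochains I r & forall a, over s a -> c a = coboundary b a.
Proof.
move=> latL distrL; elim: s I r c => [|k s IH] I r c LI cI dc.
  by exists 0 => [|a /(_ ord0)]; rewrite ?rpred0.
have sub_over q (a : multi_index n q) : over s a -> over (k :: s) a.
  by move=> sa p; rewrite inE sa orbT.
have [b bI cb] := IH I r c LI cI (fun a sa => dc a (sub_over _ a sa)).
(* The extension from k assumes that k is a new vertex. *)
have [ks|ks] := boolP (k \in s).
  exists b => // a ksa; apply: cb => p.
  by have := ksa p; rewrite inE => /orP[/eqP->|].
pose c' : indexed_family A n r.+1 := c - coboundary b.
have c'I : c' \in cochains I r.+1 by rewrite rpredB // coboundary_cochain.
have c'0 a : over s a -> c' a = 0 by move=> sa; rewrite family_subE cb ?subrr.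
have dc' a : over (k :: s) a -> coboundary c' a = 0.
  by move=> sa; rewrite raddfB /= coboundaryK subr0 dc.
have eE a : over s a -> coboundary (contract k c') a = 0.
  move=> sa; have: coboundary c' (prepend k a) = 0; last first.
    by rewrite coboundary_contract c'0 // sub0r => /eqP; rewrite oppr_eq0 => /eqP.
  apply: dc' => p; case: (unliftP ord0 p) => [p'|] ->;
    rewrite (prependS, prepend0) inE ?eqxx //.
  by rewrite sa orbT.
(* It suffices to match c' on the multi-indices over s, where it is 0, and on
   those of the form k a, where it is its contraction. *)
suff [g gI [g0 gk]] : exists2 g, g \in cochains I r &
    (forall a, over s a -> coboundary g a = 0) /\
    (forall a, over s a -> coboundary g (prepend k a) = contract k c' a).
  exists (b + g); first exact: rpredD.
  have c'g : c' - coboundary g \in cochains I r.+1.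
    by rewrite rpredB // coboundary_cochain.
  move=> a sa; apply/eqP; rewrite -subr_eq0 -family_subE raddfD /= opprD addrA.
  have /cochainsP[_ galt] := c'g.
  apply/eqP; apply: (vanish_over_cons galt _ _ sa) => {sa}a sa.
    by rewrite family_subE c'0 // g0 // subrr.
  by rewrite family_subE gk // [contract _ _ _]ffunE subrr.
have eI := contract_cochain k c'I.
case: r {c cI dc b bI cb} c' c'I c'0 dc' eE eI => [|r] c' c'I c'0 dc' eE eI; last first.
  have LI' j : L (subgroup_join (I j) (I k)) by case: (latL _ _ (LI j) (LI k)).
  have [f fI ef] := IH _ _ _ LI' eI eE.
  exists (cone_extension k f); first exact: cone_extension_cochain.
  split=> a sa; last by rewrite (coboundary_cone_extension _ ks sa) ef.
  rewrite -[RHS](_ : coboundary 0 a = 0); last by rewrite raddf0 ffunE.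
  by apply: (eq_coboundary _ sa) => b' /(over_avoids ks)/cone_extension0->; rewrite ffunE.
(* Degree 0: the contraction is constant over s, and its value has to be split
   by distributivity. *)
pose e j := contract k c' [ffun => j].
have const (a : multi_index n 0) : a = [ffun => a ord0].
  by apply/ffunP => p; rewrite ffunE ord1.
have eJ : {in s, forall j, e j \in subgroup_join (I j) (I k)}.
  move=> j js; have /cochainsP[+ _] := eI; move=> /(_ [ffun=> j])/index_sum0.
  by rewrite [X in I X]ffunE.
have e_const : {in s &, forall i j, e i = e j}.
  move=> i j si sj; have := eE (prepend j [ffun => i]); rewrite coboundary0E.
  move=> H; apply/eqP; rewrite -subr_eq0; apply/eqP; rewrite -[RHS]H; last first.
    move=> p; case: (unliftP ord0 p) => [p'|] ->; rewrite (prependS, prepend0) //.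
    by rewrite ffunE.
  by rewrite omit_prepend0 omit_prepend1.
have [y [z [zk yz]]] := distributive_split latL distrL (LI k) LI eJ e_const.
pose w j := if j == k then - z else if j \in s then y else 0.
exists [ffun a : multi_index n 0 => w (a ord0)].
  apply/cochainsP; split=> [a|]; last exact: alternating0.
  rewrite ffunE /w; apply: (mem_index_sum (p := ord0)).
  by case: eqP => [->|_]; [rewrite rpredN | case: ifP => [/yz[]|]; rewrite ?rpred0].
have ws j : j \in s -> w j = y.
  by move=> js; rewrite /w js; case: eqP js => // ->; rewrite (negPf ks).
split=> a sa; rewrite coboundary0E [X in X - _]ffunE [X in _ - X]ffunE.
  by rewrite !ws ?subrr // ffunE.
rewrite omit_prepend0 omit_prepend1 [X in _ - w X]ffunE ws // /w eqxx opprK.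
by have [_ <-] := yz _ (sa ord0); rewrite /e -const.
Qed.

End Cochains.

(** * Cohomology in degree 0 *)

Section DegreeZero.
Variables (A : zmodType) (n : nat) (I : 'I_n.+1 -> zmodClosed A).
Let meet := \big[@subgroup_meet A / full_subgroup A]_(k < n.+1) I k.

Definition constant_family (x : A) : indexed_family A n 0 := [ffun=> x].

Lemma constant_cocycle (i : subgroup_type meet) :
  constant_family (subgroup_val i) \in cocycles I 0.
Proof.
case: i => x /= xm; have /big_meetP xI := xm; apply/andP; split.
  apply/cochainsP; split=> [a|]; last exact: alternating0.
  by rewrite ffunE; apply: (mem_index_sum (p := ord0)).
by apply/eqP/ffunP => a; rewrite coboundary0E !ffunE subrr.
Qed.

Lemma cocycle0_constant (c : indexed_family A n 0) : c \in cocycles I 0 ->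
  exists2 x, x \in meet & c = constant_family x.
Proof.
move=> /andP[/cochainsP[cI _] /eqP dc].
have c_const a b : c a = c b.
  have /ffunP/(_ (prepend (b ord0) a)) := dc.
  rewrite coboundary0E omit_prepend0 omit_prepend1 [RHS]ffunE => /eqP; rewrite subr_eq0 => /eqP->.
  by congr (c _); apply/ffunP => p; rewrite ffunE (ord1 p).
exists (c [ffun=> ord0]); last by apply/ffunP => a; rewrite ffunE; apply: c_const.
apply/big_meetP => k; rewrite (c_const _ [ffun=> k]).
by have := index_sum0 (cI [ffun=> k]); rewrite [X in I X]ffunE.
Qed.

Definition constant_class (i : subgroup_type meet) : cohomology I 0 :=
  cohomology_class (SubgroupType (constant_cocycle i)).

Fact constant_class_is_zmod_morphism : zmod_morphism constant_class.
Proof.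
move=> i j; rewrite /constant_class /cohomology_class.
rewrite -(raddfB (\pi_(Quotient.quot (coboundaries I 0)))%qT).
congr (_ _); apply: val_inj; apply/ffunP => a.
by rewrite /= family_subE !ffunE.
Qed.
HB.instance Definition _ :=
  GRing.isZmodMorphism.Build _ _ constant_class constant_class_is_zmod_morphism.

Lemma constant_class_bij : bijective constant_class.
Proof.
have inj : injective constant_class.
  apply: raddf_inj => i /eqP; rewrite cohomology_class_eq0.
  move=> /asboolP /ffunP /(_ [ffun=> ord0]).
  by rewrite !ffunE => i0; apply: val_inj.
have surj h : exists i, constant_class i = h.
  elim/quotW: h => -[c cZ]; have [x xI cx] := cocycle0_constant cZ.
  by exists (SubgroupType xI); congr (cohomology_class _); apply: val_inj; rewrite /= -cx.
exists (fun h => projT1 (cid (surj h))) => [i|h]; last by case: cid.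
by apply: inj; case: cid.
Qed.

End DegreeZero.

(** * Distributivity from exactness in degree 1 *)

Lemma distributive_of_exact1 (A : zmodType) (L : set (zmodClosed A)) :
  (forall I : 'I_3 -> zmodClosed A, (forall k, L (I k)) ->
     forall c, c \in cocycles I 1 -> is_coboundary I c) ->
  distributive_lattice L.
Proof.
move=> H1 J0 J1 J2 L0 L1 L2; apply: subgroup_ext => x.
apply/idP/idP; first exact: join_meet_sub.
move=> /meetP[x01 x02].
pose I (j : 'I_3) := if j == 0 then J0 else if j == 1 then J1 else J2.
have LI j : L (I j) by rewrite /I; do 2?case: ifP.
(* The 1-cocycle (x, x, 0) at (01, 02, 12) is the coboundary of (0, x, x), which
   is a cochain only for larger subgroups; so d u is alternating and closed. *)
pose u : indexed_family A 2 0 :=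
  [ffun a : multi_index 2 0 => if a ord0 == 0 then 0 else x].
have duE (a : multi_index 2 1) : coboundary u a =
    (if a (lift ord0 ord0) == 0 then 0 else x) - (if a ord0 == 0 then 0 else x).
  by rewrite coboundary0E -{1 2}(prependK a) omit_prepend0 omit_prepend1 !ffunE.
have uC : u \in cochains (fun=> full_subgroup A) 0.
  apply/cochainsP; split=> [a|]; last exact: alternating0.
  exact: (mem_index_sum (p := ord0)).
have xI i j : i == 0 -> j != 0 -> x \in subgroup_join (I i) (I j).
  by move=> i0 /negPf j0; rewrite /I i0 j0; case: ifP.
have [|b /cochainsP[bI _] ub] := H1 I LI (coboundary u).
  apply/andP; rewrite coboundaryK eqxx; split=> //; apply/cochainsP.
  have /cochainsP[_ ualt] := coboundary_cochain uC; split=> // a.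
  have sub i j : {subset subgroup_join (I (a i)) (I (a j)) <= index_sum I a}.
    by apply: join_subP => y; apply: mem_index_sum.
  rewrite duE; case: ifPn => a1; case: ifPn => a0; rewrite ?subrr ?rpred0 //.
    by rewrite sub0r rpredN (sub (lift ord0 ord0) ord0) ?xI.
  by rewrite subr0 (sub ord0 (lift ord0 ord0)) ?xI.
pose v j := b [ffun=> j].
have vI j : v j \in I j by have := index_sum0 (bI [ffun=> j]); rewrite [X in I X]ffunE.
have uv i j : v j - v i = (if j == 0 then 0 else x) - (if i == 0 then 0 else x).
  have := duE (prepend i [ffun=> j]).
  by rewrite ub coboundary0E omit_prepend0 omit_prepend1 prepend0 prependS ffunE.
have v10 : x = - v 0 + v 1 by rewrite addrC uv /= subr0.
have v12 : v 1 = v 2 by apply/eqP; rewrite -subr_eq0 uv /= subrr.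
apply/joinP; exists (- v 0); first by rewrite rpredN (vI 0).
exists (v 1) => //; apply/meetP; split; first exact: (vI 1).
by rewrite v12; exact: (vI 2).
Qed.

Theorem theorem2 (A : zmodType) (L : set (zmodClosed A))
    (hL : subgroup_lattice L) :
  [/\ forall (n : nat) (I : 'I_n.+1 -> zmodClosed A), (forall k, L (I k)) ->
        exists f : {additive
            subgroup_type (\big[@subgroup_meet A / full_subgroup A]_(k < n.+1) I k)
            -> cohomology I 0},
          bijective f /\
          (forall i, exists2 z : subgroup_type (cocycles I 0),
             (forall a, subgroup_val z a = subgroup_val i) &
             f i = cohomology_class z),
      distributive_lattice L ->
        forall (n : nat) (I : 'I_n.+1 -> zmodClosed A), (forall k, L (I k)) ->
        forall q : nat, (0 < q)%N -> forall h : cohomology I q, h = 0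
    & (forall I : 'I_3 -> zmodClosed A, (forall k, L (I k)) ->
         forall h : cohomology I 1, h = 0) ->
        distributive_lattice L].
Proof.
split=> [n I LI|distrL n I LI [//|q] _|H1].
- exists (constant_class (I := I)); split; first exact: constant_class_bij.
  by move=> i; exists (SubgroupType (constant_cocycle i)) => // a; rewrite /= ffunE.
- apply/cohomology_eq0P => c /andP[cI /eqP dc].
  have [|b bI cb] := exact_over (s := enum 'I_n.+1) hL distrL LI cI.
    by move=> a _; rewrite dc ffunE.
  by exists b => //; apply/ffunP => a; apply: cb => p; rewrite mem_enum.
- by apply: distributive_of_exact1 => I LI; apply/cohomology_eq0P/H1.
Qed.
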